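(* Let $(X,\|\cdot\|_X)$ be a normed space whose dual $X^*$ is separable, let $(Y,\|\cdot\|_Y)$ be a normed space, and let $\Phi=(\phi_k)_{k\geq 1}$ be a dense subset of $B_{X^*}(1)$. Set $B_X(r)=\{u\in X : \|u\|_X\leq r\}$ for $r>0$, and let $|\cdot|_\Phi$ be the very weak norm on $X$ associated with $\Phi$, defined by $$|u|_\Phi := \sum_{k=1}^\infty 2^{-k}|\langle \phi_k,u\rangle| \qquad \text{for } u\in X.$$ Let $T:(X,\|\cdot\|_X)\to Y$ be a completely continuous linear operator. Then the following holds: (i) The operator $T$ is Ehrling continuous with the pair $(\|\cdot\|_X,|\cdot|_\Phi)$, i.e., for any $\varepsilon>0$ there exists a constant $C_\varepsilon>0$ such that $$\|Tu\|_Y\leq \varepsilon\|u\|_X+C_\varepsilon|u|_\Phi \qquad\text{for all } u\in X.$$ (ii) If, in addition, $X$ is reflexive and $T$ is injective (in this case, $X$ is separable and reflexive and $T$ is a compact embedding), then for $r>0$ the metric space $(T(B_X(r)),\|\cdot\|_Y)$ is homeomorphic to $(B_X(r),|\cdot|_\Phi)$, which is a compact metric space, and for any $\varepsilon>0$ there exists a constant $C_\varepsilon>0$ such that for all $u\in X$, $$|u|_\Phi\leq \varepsilon\|u\|_X+C_\varepsilon\|Tu\|_Y.$$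
   Context: $\langle\cdot,\cdot\rangle$ denotes the duality pairing between $X^*$ and $X$; $B_{X^*}(1)$ is the closed unit ball of $X^*$ for the dual norm, and density of $\Phi$ is with respect to the dual norm. For a norm $\|\cdot\|$ and a subset $B$ of the space, $(B,\|\cdot\|)$ denotes the metric space $B$ with metric $d(u,v)=\|u-v\|$. A linear operator $T:X\to Y$ between normed spaces is completely continuous if it maps every weakly convergent sequence in $X$ to a strongly convergent sequence in $Y$; it is compact if it maps every bounded subset of $X$ to a relatively compact subset of $Y$. These notions are distinguished. A compact embedding is an injective compact linear operator. For two norms $\|\cdot\|_1,\|\cdot\|_2$ on $X$, a linear operator $T:X\to Y$ is Ehrling continuous with the pair $(\|\cdot\|_1,\|\cdot\|_2)$ if for any $\varepsilon>0$ there exists $C_\varepsilon>0$ such that $\|Tu\|_Y\leq\varepsilon\|u\|_1+C_\varepsilon\|u\|_2$ for all $u\in X$. *)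

(* Defs.v *)
From HB Require Import structures.
From mathcomp Require Import all_boot all_order all_algebra.
From mathcomp Require Import all_classical all_reals all_analysis.

Set Implicit Arguments.
Unset Strict Implicit.
Unset Printing Implicit Defensive.
Import Order.TTheory GRing.Theory Num.Theory.
Import numFieldNormedType.Exports.
Local Open Scope classical_set_scope.
Local Open Scope ring_scope.

Definition norm_ball (R : realType) (V : normedModType R) (r : R) : set V :=
  [set u | `|u| <= r].
Arguments norm_ball {R} V r.

Definition separable (S : topologicalType) : Prop :=
  exists2 D : set S, countable D & dense D.

Definition homeomorphic (S U : topologicalType) : Prop :=
  exists (f : S -> U) (g : U -> S),
    [/\ cancel f g, cancel g f, continuous f & continuous g].

Section Dual.
Context {R : realType} (X : normedModType R).

Definition continuous_linear : {pred X -> R^o} :=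
  fun f => `[< linear f /\ continuous f >].

Record dual := Dual {
  dual_fun :> X -> R^o ;
  dual_funP : dual_fun \in continuous_linear }.

HB.instance Definition _ := [isSub for dual_fun].
HB.instance Definition _ := [Choice of dual by <:].

Fact continuous_linear_submod : submod_closed continuous_linear.
Proof.
split=> [|a f g]; rewrite !unfold_in.
  by apply/asboolP; split=> [c u v|x]; [rewrite scaler0 addr0|exact: cvg_cst].
move=> /asboolP[fl fc] /asboolP[gl gc]; apply/asboolP; split.
  move=> c u v; rewrite -[LHS]/(a *: f (c *: u + v) + g (c *: u + v)).
  rewrite -[RHS]/(c *: (a *: f u + g u) + (a *: f v + g v)).
  by rewrite fl gl !scalerDr !scalerA mulrC addrACA.
by move=> x; apply: cvgD; [apply: cvgZl_tmp; exact: fc|exact: gc].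
Qed.
HB.instance Definition _ :=
  GRing.isSubmodClosed.Build R (X -> R^o) continuous_linear
    continuous_linear_submod.
HB.instance Definition _ := [SubChoice_isSubLmodule of dual by <:].

Fact dual_fun_linear (f : dual) : linear f.
Proof. by have /asboolP[] := dual_funP f. Qed.
HB.instance Definition _ (f : dual) :=
  GRing.isLinear.Build R X R^o *:%R (dual_fun f) (dual_fun_linear f).
Fact dual_fun_continuous (f : dual) : continuous f.
Proof. by have /asboolP[] := dual_funP f. Qed.

Definition dual_norm (f : dual) : R :=
  sup [set `|f u| | u in norm_ball X 1].

Lemma dual_norm_has_sup (f : dual) :
  has_sup [set `|f u| | u in norm_ball X 1].
Proof.
split; first by exists `|f 0|, 0 => //=; rewrite /norm_ball/= normr0.
have /linear_bounded_continuous/bounded_funP/(_ 1)[M fM] :=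
  @dual_fun_continuous f.
by exists M => _ [u u1 <-]; exact: fM.
Qed.

Lemma dual_norm_ball (f : dual) u : norm_ball X 1 u -> `|f u| <= dual_norm f.
Proof. by move=> u1; apply: (sup_upper_bound (dual_norm_has_sup f)); exists u. Qed.

Lemma dual_norm_ge0 (f : dual) : 0 <= dual_norm f.
Proof.
rewrite (le_trans _ (@dual_norm_ball f 0 _)) //.
by rewrite /norm_ball/= normr0.
Qed.

Lemma dual_normP (f : dual) u : `|f u| <= dual_norm f * `|u|.
Proof.
have [->|u0] := eqVneq u 0; first by rewrite linear0 !normr0 mulr0.
have nu : 0 < `|u| by rewrite normr_gt0.
have /dual_norm_ball : norm_ball X 1 (`|u|^-1 *: u).
  by rewrite /norm_ball/= normrZ normfV normr_id mulVf ?gt_eqF.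
by move=> /(_ f); rewrite linearZ/= normrZ normfV normr_id mulrC ler_pdivrMr.
Qed.

Lemma dual_norm_le (f : dual) (M : R) :
  (forall u, norm_ball X 1 u -> `|f u| <= M) -> dual_norm f <= M.
Proof.
move=> fM; apply: sup_le_ub; first by have [] := dual_norm_has_sup f.
by move=> _ [u u1 <-]; exact: fM.
Qed.

Fact dual_ler_normD (f g : dual) : dual_norm (f + g) <= dual_norm f + dual_norm g.
Proof.
apply: dual_norm_le => u u1; rewrite (le_trans (ler_normD _ _))//.
by rewrite lerD ?dual_norm_ball.
Qed.

Fact dual_normrZ_le (a : R) (f : dual) : dual_norm (a *: f) <= `|a| * dual_norm f.
Proof.
apply: dual_norm_le => u u1; rewrite [leLHS]normrZ.
by rewrite ler_wpM2l ?dual_norm_ball.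
Qed.

Fact dual_normrZ (a : R) (f : dual) : dual_norm (a *: f) = `|a| * dual_norm f.
Proof.
apply/eqP; rewrite eq_le dual_normrZ_le/=.
have [->|a0] := eqVneq a 0; first by rewrite normr0 mul0r dual_norm_ge0.
rewrite -ler_pdivlMl ?normr_gt0// -normfV.
by have := dual_normrZ_le a^-1 (a *: f); rewrite scalerK.
Qed.

Fact dual_norm0_eq0 (f : dual) : dual_norm f = 0 -> f = 0.
Proof.
move=> f0; apply/val_inj/funext => u; apply/eqP; rewrite -normr_le0.
by rewrite (le_trans (dual_normP f u))// f0 mul0r.
Qed.

HB.instance Definition _ :=
  Lmodule_isNormed.Build R dual dual_ler_normD dual_normrZ dual_norm0_eq0.

End Dual.

Section Evaluation.
Context {R : realType} (X : normedModType R).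

Fact eval_subproof (u : X) :
  (fun f : dual X => f u : R^o) \in @continuous_linear R (dual X).
Proof.
rewrite unfold_in; apply/asboolP; split => //.
pose e := (fun f : dual X => f u : R^o).
have el : linear e by [].
pose E : {linear dual X -> R^o} := HB.pack e (GRing.isLinear.Build _ _ _ _ _ el).
apply: (@bounded_linear_continuous R _ _ E).
apply/bounded_funP => r; exists (r * `|u|) => f fr.
by rewrite (le_trans (dual_normP f u))// ler_wpM2r.
Qed.

Definition bidual_map (u : X) : dual (dual X) := Dual (eval_subproof u).

Definition reflexive_space : Prop :=
  forall F : dual (dual X), exists u : X, bidual_map u = F.

End Evaluation.

Definition weakly_cvg (R : realType) (X : normedModType R)
    (u : nat -> X) (l : X) : Prop :=
  forall f : dual X, f (u n) @[n --> \oo] --> f l.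

Section Operators.
Context {R : realType} (X Y : normedModType R) (T : {linear X -> Y}).

Definition completely_continuous : Prop :=
  forall (u : nat -> X) (l : X), weakly_cvg u l -> cvgn (T \o u).

Definition compact_operator : Prop :=
  forall A : set X, bounded_set A -> precompact (T @` A).

Definition compact_embedding : Prop := injective T /\ compact_operator.

Definition Ehrling_continuous (N1 N2 : X -> R) : Prop :=
  forall eps : R, 0 < eps -> exists2 C : R, 0 < C &
    forall u : X, `|T u| <= eps * N1 u + C * N2 u.

End Operators.

Record is_norm (R : realType) (V : lmodType R) (N : V -> R) : Prop := IsNorm {
  is_normD : forall u v, N (u + v) <= N u + N v ;
  is_normZ : forall (a : R) u, N (a *: u) = `|a| * N u ;
  is_norm0_eq0 : forall u, N u = 0 -> u = 0 }.

(* A copy of V normed by N, forgetting any norm V may already carry. *)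
Definition normed_by (R : realType) (V : lmodType R) (N : V -> R)
  (_ : is_norm N) : Type := V.

Section NormedBy.
Context (R : realType) (V : lmodType R) (N : V -> R) (hN : is_norm N).
HB.instance Definition _ := GRing.Lmodule.on (normed_by hN).
HB.instance Definition _ := Lmodule_isNormed.Build R (normed_by hN)
  (is_normD hN) (is_normZ hN) (is_norm0_eq0 hN).
End NormedBy.

Lemma normed_byE (R : realType) (V : lmodType R) (N : V -> R)
  (hN : is_norm N) (u : normed_by hN) : `|u| = N u.
Proof. by []. Qed.

(* The metric space B with distance `|u - v|: the library's subtype structure
   on a set of a normed module, as metric_subspace_ballE confirms. *)
Definition metric_subspace (R : realType) (V : normedModType R) (B : set V) :
  pseudoMetricType R := set_type B.

Lemma metric_subspace_ballE (R : realType) (V : normedModType R) (B : set V)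
    (x y : metric_subspace B) (e : R) :
  ball x e y = (`|set_val x - set_val y| < e) :> Prop.
Proof. by rewrite -[LHS]/(ball (set_val x) e (set_val y)) -ball_normE. Qed.

(* phi is indexed from 0: phi k and 2 ^- k.+1 are the (k+1)-st functional and
   weight of the usual 1-based enumeration. *)
Definition dense_in_dual_ball (R : realType) (X : normedModType R)
    (phi : nat -> dual X) : Prop :=
  range phi `<=` norm_ball (dual X) 1 /\
  norm_ball (dual X) 1 `<=` closure (range phi).

(* The series converges as soon as the phi k are bounded. *)
Definition very_weak_norm (R : realType) (X : normedModType R)
    (phi : nat -> dual X) (u : X) : R :=
  limn (series (fun k => 2 ^- k.+1 * `|phi k u|)).

(* Main.v *)
Require Import Defs.
From HB Require Import structures.
From mathcomp Require Import all_boot all_order all_algebra.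
From mathcomp Require Import all_classical all_reals all_analysis.
From mathcomp Require Import ring lra.

(** Everything rests on one fact: on norm-bounded sets the very weak norm
    induces the weak topology. If [x i] is bounded and its very weak norm tends
    to 0, then every [phi k (x i)] tends to 0, and density of [phi] in the dual
    ball extends this to all functionals ([weak_cvg0_of_very_weak]). Conversely,
    if all the [phi k (x i)] tend to 0, then so does the very weak norm, because
    the tail of the series from [n] on is at most [2 ^- n * `|x i|]
    ([very_weak_cvg0]).

    The first inequality is then proved by contradiction
    ([ehrling_by_contradiction]): if no constant works, rescaling produces a
    bounded sequence [w] with [`|T (w n)| = 1] whose very weak norm tends to 0;
    [w] tends weakly to 0, so [T (w n)] tends to 0, which is absurd. Scaling by
    [`|T u|] instead of [`|u|] makes the argument independent of the
    boundedness of [T].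

    If [X] is reflexive, its balls are compact for the very weak norm
    ([very_weak_ball_compact]): along an ultrafilter of a ball, every functional
    has a limit; this limit depends linearly and continuously on the functional,
    so it is the evaluation at some point [l], and the ultrafilter converges
    weakly to [l]. The reverse inequality follows by the same rescaling: now [w]
    has very weak norm 1 and [T (w n)] tends to 0; at a very weak cluster point
    [u], [T u = 0] by the first inequality, so [u = 0] by injectivity, although
    [u] is a cluster point of vectors of very weak norm 1.

    On a ball each of the two inequalities says that smallness of one side
    forces smallness of the other ([ehrling_modulus]); hence [T] and its inverse
    are continuous between the ball with the very weak norm and its image. The
    operator is compact because it maps balls onto continuous images of compact
    sets. Separability of [X] is the classical consequence of a countable dense
    subset of the dual ball: vectors almost norming the [phi k] span a dense
    subspace.

    The Hahn-Banach theorem enters three times: a vector killed by all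
    functionals vanishes, the weak limit of a ball stays in the ball, and a
    proper closed subspace is annihilated by a nonzero functional. *)

Set Implicit Arguments.
Unset Strict Implicit.
Unset Printing Implicit Defensive.
Import Order.TTheory GRing.Theory Num.Theory.
Import numFieldNormedType.Exports.
Local Open Scope classical_set_scope.
Local Open Scope ring_scope.

(** * The Hahn-Banach theorem by minimal sublinear functionals *)

(** Homogeneity is stated as an inequality, which is all that has to be checked
    for infima; [sublinearZ] recovers the equality. *)
Record sublinear (R : realType) (V : lmodType R) (q : V -> R) : Prop :=
  Sublinear {
    sublinearD : forall u v, q (u + v) <= q u + q v ;
    sublinearZ_le : forall a u, 0 <= a -> q (a *: u) <= a * q u }.

Lemma sublinear0 (R : realType) (V : lmodType R) (q : V -> R) :
  sublinear q -> q 0 = 0.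
Proof.
move=> [qD qZ]; apply/eqP; rewrite eq_le; apply/andP; split.
  by have := qZ 0 0 (lexx _); rewrite scaler0 mul0r.
by have := qD 0 0; rewrite addr0 lerDl.
Qed.

Lemma sublinearZ (R : realType) (V : lmodType R) (q : V -> R) (a : R) (u : V) :
  sublinear q -> 0 <= a -> q (a *: u) = a * q u.
Proof.
move=> sq; rewrite le_eqVlt => /predU1P[<-|a0].
  by rewrite scale0r mul0r sublinear0.
apply/eqP; rewrite eq_le sublinearZ_le ?(ltW a0)//= -ler_pdivlMl//.
by rewrite -{1}(scale1r u) -(@mulVf _ a) ?gt_eqF// -scalerA
  sublinearZ_le// invr_ge0 ltW.
Qed.

Lemma sublinear_oppr_ge (R : realType) (V : lmodType R) (q : V -> R) (u : V) :
  sublinear q -> - q (- u) <= q u.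
Proof.
by move=> sq; rewrite lerNl -subr_ge0 opprK addrC -(sublinear0 sq)
  -(subrr u) sublinearD.
Qed.

Lemma sublinear_odd_linear (R : realType) (V : lmodType R) (q : V -> R^o) :
  sublinear q -> (forall u, q (- u) <= - q u) -> linear q.
Proof.
move=> sq qN.
have qNE u : q (- u) = - q u.
  by apply/eqP; rewrite eq_le qN/= lerNl sublinear_oppr_ge.
have qDE u v : q (u + v) = q u + q v.
  apply/eqP; rewrite eq_le sublinearD//= -[leLHS]opprK opprD -!qNE.
  by rewrite lerNl -qNE opprD sublinearD.
move=> a u v; rewrite qDE; congr (_ + _).
have [a0|a0] := leP 0 a; first exact: sublinearZ.
rewrite -[a *: u]opprK qNE -scaleNr sublinearZ ?oppr_ge0 ?ltW//.
by rewrite mulNr opprK.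
Qed.

(** A sublinear functional below [q] whose values at [y] and [- y] are opposite:
    lowering [q] in this way is impossible only if [q] is already odd at [y]. *)
Definition sublinear_lower (R : realType) (V : lmodType R) (q : V -> R)
    (y x : V) : R :=
  inf [set q (x + t *: y) - t * q y | t in [set t : R | 0 <= t]].

Section SublinearLower.
Context (R : realType) (V : lmodType R) (q : V -> R) (sq : sublinear q) (y : V).

Let lowerS (x : V) := [set q (x + t *: y) - t * q y | t in [set t : R | 0 <= t]].

(* The bound does not depend on [t]: subadditivity on
   [t *: y = (x + t *: y) + (- x)]. *)
Let lowerS_lb x : has_lbound (lowerS x).
Proof.
exists (- q (- x)) => _ [t t0 <-].
have := sublinearD sq (x + t *: y) (- x).
by rewrite [x + _]addrC addrK sublinearZ//; lra.
Qed.

Let lower_le_at x (t : R) :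
  0 <= t -> sublinear_lower q y x <= q (x + t *: y) - t * q y.
Proof. by move=> t0; apply: ge_inf; [exact: lowerS_lb|exists t]. Qed.

Let le_lower x c : (forall t, 0 <= t -> c <= q (x + t *: y) - t * q y) ->
  c <= sublinear_lower q y x.
Proof.
move=> h; apply: lb_le_inf; first by exists (q (x + 0 *: y) - 0 * q y), 0 => /=.
by move=> _ [t t0 <-]; exact: h.
Qed.

Lemma sublinear_lower_le x : sublinear_lower q y x <= q x.
Proof. by have := lower_le_at x (lexx 0); rewrite scale0r addr0 mul0r subr0. Qed.

Lemma sublinear_lowerN : sublinear_lower q y (- y) <= - q y.
Proof.
have := lower_le_at (- y) ler01.
by rewrite scale1r addNr (sublinear0 sq) mul1r add0r.
Qed.

Lemma sublinear_lower_sublinear : sublinear (sublinear_lower q y).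
Proof.
split=> [u v|a u a0].
  rewrite -lerBlDr; apply: le_lower => s s0.
  rewrite lerBlDr -lerBlDl; apply: le_lower => t t0.
  rewrite lerBlDl (le_trans (lower_le_at _ (addr_ge0 s0 t0)))//.
  have := sublinearD sq (u + s *: y) (v + t *: y).
  by rewrite addrACA -scalerDl; lra.
move: a0; rewrite le_eqVlt => /predU1P[<-|a0].
  by rewrite scale0r mul0r -(sublinear0 sq) sublinear_lower_le.
rewrite -ler_pdivrMl//; apply: le_lower => t t0.
rewrite ler_pdivrMl// (le_trans (lower_le_at _ (mulr_ge0 (ltW a0) t0)))//.
by rewrite -scalerA -scalerDr (sublinearZ _ sq (ltW a0)) mulrBr mulrA.
Qed.

End SublinearLower.

(** The functionals below [p] that are minimal among sublinear ones are linear: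
    by minimality [q] equals [sublinear_lower q y] for every [y], so [q] is odd.
    Minimal ones exist by Zorn's lemma, since the pointwise infimum of a chain is
    again sublinear. No linear functional on a proper subspace is ever
    extended. *)
Lemma linear_below_sublinear (R : realType) (V : lmodType R) (p : V -> R) :
  sublinear p -> exists2 f : V -> R^o, linear f & forall u, f u <= p u.
Proof.
move=> sp.
pose S := {q : V -> R | sublinear q /\ forall u, q u <= p u}.
pose s0 : S := exist _ p (conj sp (fun u => lexx (p u))).
pose rel_ge : rel S := fun s t => `[< forall u, sval t u <= sval s u >].
have [] := @ZL_preorder S s0 rel_ge.
- by move=> s; apply/asboolP.
- move=> r s t /asboolP rs /asboolP st; apply/asboolP => u.
  exact: le_trans (st u) (rs u).
- move=> A totA.
  (* The infimum over the chain; [p] itself bounds the empty chain. *)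
  have [[a Aa]|A0] := pselect (exists a, A a); last first.
    by exists s0 => s As; case: A0; exists s.
  pose I u := [set sval s u | s in A].
  have I0 u : nonempty (I u) by exists (sval a u), a.
  have Ilb u : has_lbound (I u).
    exists (- p (- u)) => _ [s As <-]; case: s As => q [sq qp] /= _.
    by rewrite (le_trans _ (sublinear_oppr_ge u sq))// lerN2.
  have Ile u s : A s -> inf (I u) <= sval s u.
    by move=> As; apply: ge_inf => //; exists s.
  have sI : sublinear (fun u => inf (I u)).
    split=> [u v|c u c0].
      rewrite -lerBlDr; apply: lb_le_inf => // _ [s As <-].
      rewrite lerBlDr -lerBlDl; apply: lb_le_inf => // _ [t At <-].
      rewrite lerBlDl.
      have [/asboolP st|/asboolP ts] := totA s t As At.
        rewrite (le_trans (Ile _ _ At))//.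
        by rewrite (le_trans (sublinearD (svalP t).1 _ _))// lerD2r.
      rewrite (le_trans (Ile _ _ As))//.
      by rewrite (le_trans (sublinearD (svalP s).1 _ _))// lerD2l.
    move: c0; rewrite le_eqVlt => /predU1P[<-|c0].
      rewrite scale0r mul0r (le_trans (Ile _ _ Aa))//.
      by rewrite (sublinear0 (svalP a).1).
    rewrite -ler_pdivrMl//; apply: lb_le_inf => // _ [s As <-].
    rewrite ler_pdivrMl// (le_trans (Ile _ _ As))//.
    by rewrite (sublinearZ_le (svalP s).1)// ltW.
  have Ip u : inf (I u) <= p u.
    by rewrite (le_trans (Ile u a Aa))//; exact: (svalP a).2.
  pose t : S := exist _ (fun u => inf (I u)) (conj sI Ip).
  exists t => s As; apply/asboolP => u /=.
  exact: Ile.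
move=> [q [sq qp]] minq; exists q => //; apply: sublinear_odd_linear => // y.
have lp u : sublinear_lower q y u <= p u.
  exact: le_trans (sublinear_lower_le sq y u) (qp u).
pose l : S :=
  exist _ (sublinear_lower q y) (conj (sublinear_lower_sublinear sq y) lp).
have /asboolP/(_ (- y))/= ql : rel_ge l (exist _ q (conj sq qp)).
  by apply: minq; apply/asboolP => u /=; exact: sublinear_lower_le.
exact: le_trans ql (sublinear_lowerN sq y).
Qed.

(** Hahn-Banach: [p] has a supporting linear functional at each point. Lowering
    [p] at [x] first forces every linear functional below to be at least [p x]
    at [x]. *)
Theorem sublinear_support (R : realType) (V : lmodType R) (p : V -> R) (x : V) :
  sublinear p ->
  exists f : V -> R^o, [/\ linear f, forall u, f u <= p u & f x = p x].
Proof.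
move=> sp.
have [f fl fp] := linear_below_sublinear (sublinear_lower_sublinear sp x).
have fle u : f u <= p u := le_trans (fp u) (sublinear_lower_le sp x u).
exists f; split => //; apply/eqP; rewrite eq_le fle/=.
pose E : {linear V -> R^o} := HB.pack f (GRing.isLinear.Build _ _ _ _ _ fl).
have := le_trans (fp (- x)) (sublinear_lowerN sp x).
by have -> : f (- x) = - f x := linearN E x; rewrite lerN2.
Qed.

Lemma dual_apply_le (R : realType) (X : normedModType R) (f : dual X) (u : X) :
  `|f u| <= `|f| * `|u|.
Proof. exact: dual_normP. Qed.

Lemma bounded_linear_dual (R : realType) (V : normedModType R) (L : V -> R^o)
    (M : R) :
  linear L -> (forall u, `|L u| <= M * `|u|) ->
  exists g : dual V, forall u, g u = L u.
Proof.
move=> Ll LM.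
pose E : {linear V -> R^o} := HB.pack L (GRing.isLinear.Build _ _ _ _ _ Ll).
have Lc : continuous L.
  apply: (@bounded_linear_continuous R _ _ E); apply/bounded_funP => r.
  exists (`|M| * r) => u ur; rewrite (le_trans (LM u))//.
  by rewrite (le_trans (ler_wpM2r _ (ler_norm M)))// ler_wpM2l.
have LP : L \in @continuous_linear R V by rewrite unfold_in; apply/asboolP.
by exists (Dual LP).
Qed.

Lemma dual_of_le_norm (R : realType) (X : normedModType R) (f : X -> R^o) :
  linear f -> (forall u, f u <= `|u|) ->
  exists2 g : dual X, `|g| <= 1 & forall u, g u = f u.
Proof.
move=> fl fle.
pose E : {linear X -> R^o} := HB.pack f (GRing.isLinear.Build _ _ _ _ _ fl).
have fN u : `|f u| <= 1 * `|u|.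
  rewrite mul1r ler_norml fle andbT lerNl.
  by have := fle (- u); rewrite normrN; have -> : f (- u) = - f u := linearN E u.
have [g gE] := bounded_linear_dual fl fN.
exists g => //; apply: dual_norm_le => u u1; rewrite gE.
by rewrite (le_trans (fN u))// mul1r.
Qed.

Theorem norming_functional (R : realType) (X : normedModType R) (x : X) :
  exists2 f : dual X, `|f| <= 1 & f x = `|x|.
Proof.
have sN : sublinear (fun u : X => `|u|).
  split=> [u v|a u a0]; first exact: ler_normD.
  by rewrite normrZ (ger0_norm a0).
have [f [fl fle fx]] := sublinear_support x sN.
by have [g g1 gE] := dual_of_le_norm fl fle; exists g; rewrite ?gE.
Qed.

(** The distance to [W] is sublinear, at most the norm, and zero on [W]; its
    supporting functional at [x] therefore vanishes on [W] and takes at [x] the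
    distance from [x] to [W], which is at least [d]. *)
Theorem annihilating_functional (R : realType) (X : normedModType R)
    (W : set X) (x : X) (d : R) :
  W 0 -> (forall u v, W u -> W v -> W (u + v)) ->
  (forall a u, W u -> W (a *: u)) ->
  0 < d -> (forall w, W w -> d <= `|x - w|) ->
  exists2 f : dual X, f x != 0 & forall w, W w -> f w = 0.
Proof.
move=> W0 WD WZ d0 xW.
(* [p] is the distance to [W]. *)
pose S u := [set `|u - w| | w in W].
pose p u := inf (S u).
have S0 u : nonempty (S u) by exists `|u - 0|, 0.
have Slb u : has_lbound (S u) by exists 0 => _ [w _ <-].
have ple u w : W w -> p u <= `|u - w|.
  by move=> Ww; apply: ge_inf => //; exists w.
have lep u c : (forall w, W w -> c <= `|u - w|) -> c <= p u.
  by move=> h; apply: lb_le_inf => // _ [w Ww <-]; exact: h.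
have sp : sublinear p.
  split=> [u v|a u a0].
    rewrite -lerBlDr; apply: (lep) => w Ww; rewrite lerBlDr -lerBlDl.
    apply: (lep) => z Wz; rewrite lerBlDl (le_trans (ple _ _ (WD _ _ Ww Wz)))//.
    by rewrite opprD addrACA ler_normD.
  move: a0; rewrite le_eqVlt => /predU1P[<-|a0].
    by rewrite scale0r mul0r (le_trans (ple _ _ W0))// subrr normr0.
  rewrite -ler_pdivrMl//; apply: (lep) => w Ww.
  rewrite ler_pdivrMl// (le_trans (ple _ _ (WZ a _ Ww)))//.
  by rewrite -scalerBr normrZ gtr0_norm.
have [f [fl fp fx]] := sublinear_support x sp.
have [|g _ gE] := dual_of_le_norm fl.
  by move=> u; rewrite (le_trans (fp u))// -[leRHS]/(`|u|) -{2}(subr0 u) ple.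
exists g; first by rewrite gE fx gt_eqF// (lt_le_trans d0)// lep.
have g0 w : W w -> g w <= 0.
  by move=> Ww; rewrite gE (le_trans (fp w))// (le_trans (ple _ _ Ww))// subrr normr0.
move=> w Ww; apply/eqP; rewrite eq_le g0//=.
have := g0 _ (WZ (-1) _ Ww).
by rewrite scaleN1r linearN oppr_le0.
Qed.

(** * The very weak norm on bounded sets *)

Section VeryWeakNorm.
Context (R : realType) (X : normedModType R) (phi : nat -> dual X).
Hypothesis phi_le1 : forall k, `|phi k| <= 1.

Local Notation term u := (fun k => 2 ^- k.+1 * `|phi k u| : R).
Local Notation N := (very_weak_norm phi).

Let term_ge0 (u : X) k : 0 <= term u k.
Proof. by rewrite mulr_ge0// invr_ge0 exprn_ge0. Qed.

Let series_nd u : nondecreasing_seq (series (term u)).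
Proof. by apply: nondecreasing_series => n _ _; exact: term_ge0. Qed.

Let phi_le_norm k (u : X) : `|phi k u| <= `|u|.
Proof.
rewrite (le_trans (dual_apply_le _ _))// ler_piMl//; exact: phi_le1.
Qed.

(** The weights beyond rank [n] add up to [2 ^- n]; the induction moves one term
    at a time using [2 ^- n = 2 ^- n.+1 + 2 ^- n.+1]. *)
Lemma very_weak_partial_sum_le (u : X) n m :
  series (term u) m <= series (term u) n + 2 ^- n * `|u|.
Proof.
have half k : 2 ^- k = 2 ^- k.+1 + 2 ^- k.+1 :> R.
  by rewrite exprS invfM; field; rewrite expf_neq0.
have [mn|/ltnW nm] := leqP m n.
  rewrite (le_trans (series_nd u mn))//.
  by rewrite lerDl mulr_ge0// invr_ge0 exprn_ge0.
rewrite -(subnKC nm); move: (m - n)%N => d {nm}; elim: d n => [n|d IHd n].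
  by rewrite addn0 lerDl mulr_ge0// invr_ge0 exprn_ge0.
rewrite addnS -addSn (le_trans (IHd n.+1))// {1}seriesEnat/= big_nat_recr//=.
rewrite -[\sum_(_ <= _ < _) _]/(series (term u) n) -addrA lerD2l.
by rewrite [X in _ <= X * _]half mulrDl lerD2r ler_wpM2l// invr_ge0 exprn_ge0.
Qed.

Lemma very_weak_series_cvg (u : X) : cvgn (series (term u)).
Proof.
apply: nondecreasing_is_cvgn; first exact: series_nd.
exists (series (term u) 0 + 2 ^- 0 * `|u|) => _ [n _ <-].
exact: very_weak_partial_sum_le.
Qed.

Lemma very_weak_norm_le (u : X) n : N u <= series (term u) n + 2 ^- n * `|u|.
Proof.
apply: limr_le; first exact: very_weak_series_cvg.
by apply: nearW => m; exact: very_weak_partial_sum_le.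
Qed.

Lemma very_weak_norm_ge (u : X) k : `|phi k u| <= 2 ^+ k.+1 * N u.
Proof.
rewrite -ler_pdivrMl ?exprn_gt0//.
have := nondecreasing_cvgn_le (series_nd u) (@very_weak_series_cvg u) k.+1.
apply: le_trans.
rewrite seriesEnat/= big_nat_recr//= lerDr sumr_ge0//.
Qed.

Lemma very_weak_norm_ge0 (u : X) : 0 <= N u.
Proof.
rewrite -(@pmulr_rge0 _ (2 ^+ 1))//.
exact: le_trans (normr_ge0 _) (very_weak_norm_ge u 0).
Qed.

Lemma very_weak_normD (u v : X) : N (u + v) <= N u + N v.
Proof.
have cu := @very_weak_series_cvg u; have cv := @very_weak_series_cvg v.
rewrite /very_weak_norm -lim_seriesD//.
apply: lim_series_le; first exact: very_weak_series_cvg.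
  exact: is_cvg_seriesD.
move=> k /=; rewrite -mulrDr ler_wpM2l ?invr_ge0 ?exprn_ge0// linearD.
exact: ler_normD.
Qed.

Lemma very_weak_normZ (a : R) (u : X) : N (a *: u) = `|a| * N u.
Proof.
rewrite /very_weak_norm -[RHS]/(`|a| *: _) -lim_seriesZ; last first.
  exact: very_weak_series_cvg.
congr (limn (series _)); apply/funext => k /=.
by rewrite linearZ normrZ mulrCA.
Qed.

(** Only finitely many functionals matter on a bounded set: beyond rank [n] the
    series contributes at most [2 ^- n * (`|M| + 1)]. *)
Lemma very_weak_cvg0 I (F : set_system I) {FF : Filter F} (x : I -> X) (M : R) :
  (forall i, `|x i| <= M) ->
  (forall k, phi k (x i) @[i --> F] --> (0 : R)) ->
  N (x i) @[i --> F] --> (0 : R).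
Proof.
move=> xM phix; apply/cvgr0Pnorm_lt => e e0.
have M0 : 0 < `|M| + 1 by rewrite ltr_wpDl.
have [n nM] : exists n, 2 ^- n * (`|M| + 1) < e / 2.
  have := @cvg_geometric R (`|M| + 1) 2^-1.
  rewrite ger0_norm// invf_lt1// ltr1n => /(_ isT)/cvgr0Pnorm_lt.
  move=> /(_ (e / 2)); rewrite divr_gt0// => /(_ isT)[n _ /(_ n (leqnn n))].
  move=> /(le_lt_trans (ler_norm _))/=; rewrite exprVn mulrC => ?.
  by exists n.
have : series (term (x i)) n @[i --> F] --> (0 : R).
  rewrite (_ : 0 = \sum_(0 <= k < n) 0 :> R); last by rewrite big1.
  under eq_fun do rewrite seriesEnat/=.
  apply: cvg_big => [|k _]; first exact: add_continuous.
  rewrite -(mulr0 (2 ^- k.+1)); apply: cvgMl_tmp.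
  by rewrite -(normr0 R); exact: cvg_norm.
move=> /cvgr0Pnorm_lt/(_ (e / 2)); rewrite divr_gt0// => /(_ isT).
apply: filterS => i sx; rewrite ger0_norm ?very_weak_norm_ge0//.
rewrite (le_lt_trans (very_weak_norm_le _ n))// (splitr e) ltrD//.
  exact: le_lt_trans (ler_norm _) sx.
apply: le_lt_trans nM; rewrite ler_wpM2l ?invr_ge0 ?exprn_ge0//.
by rewrite (le_trans (xM i))// (le_trans (ler_norm _))// lerDl.
Qed.

End VeryWeakNorm.

Lemma dense_in_dual_ball_le1 (R : realType) (X : normedModType R)
  (phi : nat -> dual X) : dense_in_dual_ball phi -> forall k, `|phi k| <= 1.
Proof. by move=> [phi1 _] k; apply: phi1; exists k. Qed.

Lemma dense_in_dual_ball_approx (R : realType) (X : normedModType R)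
    (phi : nat -> dual X) (f : dual X) (e : R) :
  dense_in_dual_ball phi -> `|f| <= 1 -> 0 < e -> exists k, `|f - phi k| < e.
Proof.
move=> [_ phid] f1 e0.
have [_ [[k _ <-]]] := phid f f1 _ (nbhsx_ballx f e e0).
by rewrite -ball_normE/= => ?; exists k.
Qed.

(** Definiteness: a functional norming [u] is a limit of [phi k], all of which
    vanish at [u]. *)
Lemma very_weak_norm_is_norm (R : realType) (X : normedModType R)
  (phi : nat -> dual X) : dense_in_dual_ball phi -> is_norm (very_weak_norm phi).
Proof.
move=> phid; have phi1 := dense_in_dual_ball_le1 phid.
split; [exact: very_weak_normD|exact: very_weak_normZ|move=> u Nu0].
have phiu k : phi k u = 0.
  by apply/normr0_eq0/le_anti; rewrite normr_ge0 andbT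
    (le_trans (very_weak_norm_ge phi1 _ _))// Nu0 mulr0.
have [f f1 fu] := norming_functional u.
apply/eqP; rewrite -normr_le0; apply/ler_addgt0Pl => e e0.
rewrite addr0.
have u0 : 0 < `|u| + 1 by rewrite ltr_wpDl.
have [k fk] := dense_in_dual_ball_approx phid f1 (divr_gt0 e0 u0).
have := dual_apply_le (f - phi k) u.
rewrite -[(f - phi k) u]/(f u - phi k u) phiu subr0 fu normr_id => /le_trans; apply.
rewrite (le_trans (ler_wpM2r _ (ltW fk)))// mulrAC ler_pdivrMr// ler_wpM2l ?ltW//.
by rewrite ltrDl.
Qed.

(** After normalising [f] into the dual ball, replacing it by a nearby [phi k]
    costs at most [e / 2] uniformly on the bounded family, and [`|phi k u|] is at
    most [2 ^+ k.+1] times the very weak norm of [u]. *)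
Lemma weak_cvg0_of_very_weak (R : realType) (X : normedModType R)
    (phi : nat -> dual X) I (F : set_system I) {FF : Filter F}
    (x : I -> X) (M : R) :
  dense_in_dual_ball phi -> (forall i, `|x i| <= M) ->
  very_weak_norm phi (x i) @[i --> F] --> (0 : R) ->
  forall f : dual X, f (x i) @[i --> F] --> (0 : R).
Proof.
move=> phid xM Nx f; have phi1 := dense_in_dual_ball_le1 phid.
have c0 : 0 < `|f| + 1 by rewrite ltr_wpDl.
pose g := (`|f| + 1)^-1 *: f.
have g1 : `|g| <= 1.
  by rewrite normrZ gtr0_norm ?invr_gt0// mulrC ler_pdivrMr// mul1r lerDl.
have M0 : 0 < `|M| + 1 by rewrite ltr_wpDl.
suff gx : g (x i) @[i --> F] --> (0 : R).
  have -> : (fun i => f (x i)) = (fun i => (`|f| + 1) * g (x i)).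
    apply/funext => i; rewrite -[g (x i)]/(_^-1 * f (x i)).
    by rewrite mulrA divff ?gt_eqF// mul1r.
  by rewrite -(mulr0 (`|f| + 1)); exact: cvgMl_tmp.
apply/cvgr0Pnorm_lt => e e0.
have e2 : 0 < e / 2 by rewrite divr_gt0.
have [k gk] := dense_in_dual_ball_approx phid g1 (divr_gt0 e2 M0).
have d0 : 0 < e / 2 / 2 ^+ k.+1 by rewrite divr_gt0// exprn_gt0.
have /cvgr0Pnorm_lt/(_ _ d0) := Nx; apply: filterS => i Nxi.
have -> : g (x i) = (g - phi k) (x i) + phi k (x i) by rewrite -[RHS]/(_ - _ + _) subrK.
rewrite (le_lt_trans (ler_normD _ _))// (splitr e) ler_ltD//.
  rewrite (le_trans (dual_apply_le _ _))//.
  rewrite (le_trans (ler_wpM2r _ (ltW gk)))// mulrAC ler_pdivrMr//.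
  rewrite ler_wpM2l ?(ltW e2)// (le_trans (xM i))//.
  by rewrite (le_trans (ler_norm _))// lerDl.
rewrite (le_lt_trans (very_weak_norm_ge phi1 _ _))//.
by rewrite mulrC -ltr_pdivlMr ?exprn_gt0// (le_lt_trans (ler_norm _)).
Qed.

(** * Ehrling inequalities *)

(** If the inequality fails for every constant [n.+1], dividing the
    counterexample [u n] by [P (u n)] gives a bounded sequence on the unit
    sphere of [P] along which [Q] tends to 0. Normalising by [P] turns the failure
    into both bounds at once. *)
Lemma ehrling_by_contradiction (R : realType) (X : normedModType R)
    (P Q : X -> R) (eps : R) :
  (forall a u, P (a *: u) = `|a| * P u) ->
  (forall a u, Q (a *: u) = `|a| * Q u) ->
  (forall u, 0 <= Q u) -> 0 < eps ->
  (forall w : nat -> X, (forall n, `|w n| <= eps^-1) ->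
     (forall n, P (w n) = 1) -> (forall n, Q (w n) <= n.+1%:R^-1) -> False) ->
  exists2 C : R, 0 < C & forall u, P u <= eps * `|u| + C * Q u.
Proof.
move=> PZ QZ Q0 eps0 noseq; apply: contrapT => noC.
have bad n : exists u, eps * `|u| + n.+1%:R * Q u < P u.
  apply: contrapT => nu; apply: noC; exists n.+1%:R => // u.
  by rewrite leNgt; apply/negP => ltu; apply: nu; exists u.
have [u uP] := choice bad.
have Pu0 n : 0 < P (u n).
  by apply: le_lt_trans (uP n); rewrite addr_ge0// mulr_ge0 ?(ltW eps0).
apply: (noseq (fun n => (P (u n))^-1 *: u n)) => n.
- rewrite normrZ gtr0_norm ?invr_gt0// mulrC ler_pdivrMr// -ler_pdivrMl ?invr_gt0//.
  rewrite invrK (le_trans _ (ltW (uP n)))// lerDl mulr_ge0//.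
- by rewrite PZ gtr0_norm ?invr_gt0// mulVf// gt_eqF.
- rewrite QZ gtr0_norm ?invr_gt0// mulrC ler_pdivrMr// mulrC ler_pdivlMr//.
  by rewrite mulrC (le_trans _ (ltW (uP n)))// lerDr mulr_ge0 ?(ltW eps0).
Qed.

(** On a ball of radius [M] the term [eps * `|u|] is at most [e / 2] once [eps] is
    small; the constant belonging to this [eps] then determines [d]. *)
Lemma ehrling_modulus (R : realType) (X : normedModType R) (P Q : X -> R) :
  (forall eps : R, 0 < eps ->
     exists2 C : R, 0 < C & forall u, P u <= eps * `|u| + C * Q u) ->
  forall M e : R, 0 < e -> exists2 d : R, 0 < d &
    forall u, `|u| <= M -> Q u < d -> P u < e.
Proof.
move=> ehr M e e0.
have M0 : 0 < `|M| + 1 by rewrite ltr_wpDl.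
have e20 : 0 < e / 2 by rewrite divr_gt0.
have [C C0 PC] := ehr _ (divr_gt0 e20 M0).
exists (e / 2 / C); first by rewrite divr_gt0.
move=> u uM Qd; rewrite (le_lt_trans (PC u))// [ltRHS]splitr ler_ltD//.
  rewrite mulrAC ler_pdivrMr// ler_wpM2l ?(ltW e20)//.
  by rewrite (le_trans uM)// (le_trans (ler_norm _))// lerDl.
by rewrite mulrC -ltr_pdivlMr.
Qed.

(** Complete continuity only provides some limit. Interleaving [u] with the
    constant sequence [l] keeps the weak convergence, and the odd-indexed terms
    identify the limit as [T l]. *)
Lemma completely_continuous_cvg (R : realType) (X Y : normedModType R)
    (T : {linear X -> Y}) (u : nat -> X) (l : X) :
  completely_continuous T -> weakly_cvg u l -> T (u n) @[n --> \oo] --> T l.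
Proof.
move=> ccT ul.
pose v n := if odd n then l else u n./2.
have vl : weakly_cvg v l.
  move=> f; apply/pseudometric_normed_Zmodule.cvgrPdist_lt => e e0.
  have /pseudometric_normed_Zmodule.cvgrPdist_lt/(_ _ e0)[n _ nP] := ul f.
  exists n.*2 => // m /= nm; rewrite /v; case: ifP => _.
    by rewrite subrr normr0.
  by apply: nP; rewrite /= -(doubleK n); exact: half_leq.
have [L TvL] : exists L : Y, T (v n) @[n --> \oo] --> L.
  by exists (limn (T \o v)); exact: (ccT v l vl).
have even_oo : (n.*2 @[n --> \oo] : set_system nat) --> \oo.
  by move=> A [n _ nA]; exists n => // m /= nm; apply: nA; rewrite /= -addnn (leq_trans nm)// leq_addr.
have odd_oo : (n.*2.+1 @[n --> \oo] : set_system nat) --> \oo.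
  by move=> A [n _ nA]; exists n => // m /= nm; apply: nA; rewrite /= -addnn -addnS (leq_trans nm)// leq_addr.
have TuL : T (u n) @[n --> \oo] --> L.
  have := cvg_comp _ _ even_oo TvL; rewrite /comp.
  by under eq_fun do rewrite /v odd_double doubleK.
have TlL : T l @[n --> \oo] --> L.
  have := cvg_comp _ _ odd_oo TvL; rewrite /comp.
  by under eq_fun do rewrite /v /= odd_double.
by rewrite (cvg_unique (@norm_hausdorff _ _) (cvg_cst (T l)) TlL).
Qed.

Theorem completely_continuous_Ehrling (R : realType) (X Y : normedModType R)
    (phi : nat -> dual X) (T : {linear X -> Y}) :
  dense_in_dual_ball phi -> completely_continuous T ->
  Ehrling_continuous T (fun u : X => `|u|) (very_weak_norm phi).
Proof.
move=> phid ccT eps eps0; have phi1 := dense_in_dual_ball_le1 phid.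
apply: (@ehrling_by_contradiction _ _ (fun u => `|T u|)) => //.
- by move=> a u; rewrite linearZ normrZ.
- exact: very_weak_normZ.
- exact: very_weak_norm_ge0.
move=> w wM Tw1 Nw.
have Nw0 : very_weak_norm phi (w n) @[n --> \oo] --> (0 : R).
  apply: (@squeeze_cvgr _ _ _ _ (cst 0) (@harmonic R)).
  - by apply: nearW => n /=; rewrite very_weak_norm_ge0//=; exact: Nw.
  - exact: cvg_cst.
  - exact: cvg_harmonic.
have w0 : weakly_cvg w 0.
  by move=> f; rewrite linear0; exact: weak_cvg0_of_very_weak Nw0 f.
have := completely_continuous_cvg ccT w0.
rewrite linear0 => /cvgr0Pnorm_lt/(_ 1 ltr01)[n _ /(_ n (leqnn n))] /=.
by rewrite Tw1 ltxx.
Qed.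

(** * Separability from a countable dense subset of the dual ball *)

(** Formal combinations [s] of indices, with coefficients in [K] read through
    [c]: taking [K] countable makes the set of combinations countable, and
    taking [c = id] gives the real span. *)
Definition span_with (R : realType) (X : normedModType R) (K : Type) (c : K -> R)
  (x : nat -> X) (s : seq (K * nat)) : X := \sum_(p <- s) c p.1 *: x p.2.

Lemma rational_span_approx (R : realType) (X : normedModType R) (x : nat -> X)
    (s : seq (R * nat)) (e : R) :
  (forall k, `|x k| <= 1) -> 0 < e ->
  exists t : seq (rat * nat), `|span_with id x s - span_with ratr x t| < e.
Proof.
move=> x1; rewrite /span_with; elim: s e => [|[a k] s IHs] e e0.
  by exists [::]; rewrite !big_nil subr0 normr0.
have e20 : 0 < e / 2 by rewrite divr_gt0.
have [t st] := IHs _ e20.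
have ae : a < a + e / 2 by rewrite ltrDl.
have [q] := rat_in_itvoo ae; rewrite in_itv/= => /andP[aq qa].
exists ((q, k) :: t); rewrite !big_cons/= opprD addrACA -scalerBl.
rewrite (le_lt_trans (ler_normD _ _))// (splitr e) ler_ltD//.
rewrite normrZ (le_trans (ler_wpM2l _ (x1 k)))// mulr1.
by rewrite ler_norml; apply/andP; split; lra.
Qed.

Lemma exists_almost_norming (R : realType) (X : normedModType R) (f : dual X) :
  exists u : X, `|u| <= 1 /\ `|f| / 2 <= `|f u|.
Proof.
have := normr_ge0 f; rewrite le_eqVlt => /predU1P[<-|f0].
  by exists 0; rewrite normr0 mul0r.
have f20 : 0 < `|f| / 2 by rewrite divr_gt0.
have [_ [u u1 <-] fu] := sup_adherent f20 (dual_norm_has_sup f).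
exists u; split=> //; apply: ltW; apply: le_lt_trans fu.
by rewrite -[sup _]/(`|f|); lra.
Qed.

(** Take vectors [x k] of the unit ball almost norming the [phi k]. If their
    span were not dense, some [g] of norm 1 would annihilate it; any [phi k]
    within [1 / 4] of [g] has norm at least [3 / 4], so [`|phi k (x k)|] is at
    least [3 / 8], but it equals [`|(g - phi k) (x k)| <= 1 / 4]. Rational
    combinations of the [x k] are then dense and countably many. *)
Theorem separable_of_dense_dual_ball (R : realType) (X : normedModType R)
    (phi : nat -> dual X) : dense_in_dual_ball phi -> separable X.
Proof.
move=> phid; have phi1 := dense_in_dual_ball_le1 phid.
have [x x1] := choice (fun k => exists_almost_norming (phi k)).
have xle1 k : `|x k| <= 1 by have [] := x1 k.
pose W := range (span_with (@id R) x).
have W0 : W 0 by exists [::] => //; rewrite /span_with big_nil.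
have WD u v : W u -> W v -> W (u + v).
  by move=> [s _ <-] [t _ <-]; exists (s ++ t) => //; rewrite /span_with big_cat.
have WZ a u : W u -> W (a *: u).
  move=> [s _ <-]; exists [seq (a * p.1, p.2) | p <- s] => //.
  rewrite /span_with big_map scaler_sumr; apply: eq_bigr => p _.
  by rewrite scalerA.
have Wx k : W (x k).
  by exists [:: (1, k)] => //; rewrite /span_with big_seq1 scale1r.
have Wdense y d : 0 < d -> exists2 w, W w & `|y - w| < d.
  move=> d0; apply: contrapT => nW.
  have [|f fy fW] := annihilating_functional (x := y) W0 WD WZ d0.
    by move=> w Ww; rewrite leNgt; apply/negP => lt; apply: nW; exists w.
  have f0 : 0 < `|f|.
    rewrite normr_gt0; apply: contra_neq fy => ->.
    by [].
  pose g := `|f|^-1 *: f.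
  have g1 : `|g| = 1 by rewrite normrZ normfV normr_id mulVf ?gt_eqF.
  have q0 : 0 < 4^-1 :> R by rewrite invr_gt0.
  have [|k gk] := @dense_in_dual_ball_approx _ _ _ g _ phid _ q0.
    by rewrite g1.
  have [xk1 phix] := x1 k.
  have gx : g (x k) = 0.
    by rewrite -[LHS]/(_^-1 * f (x k)) fW// mulr0.
  have := dual_apply_le (g - phi k) (x k).
  rewrite -[(g - phi k) (x k)]/(g (x k) - phi k (x k)) gx sub0r normrN.
  have := ler_piMr (normr_ge0 (g - phi k)) xk1.
  have : `|g| <= `|g - phi k| + `|phi k|.
    by rewrite -{1}(subrK (phi k) g) ler_normD.
  rewrite g1; lra.
exists (range (span_with ratr x)); first by apply: sub_countable (card_image_le _ _) _; exact: countableP.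
move=> O [y Oy]; rewrite openE => /(_ _ Oy)/nbhs_ballP[e/= e0 yeO].
have e20 : 0 < e / 2 by rewrite divr_gt0.
have [_ [s _ <-] ys] := Wdense y _ e20.
have [t st] := rational_span_approx s xle1 e20.
exists (span_with ratr x t); split; last by exists t.
apply: yeO; rewrite -ball_normE/=.
rewrite -[y](subrK (span_with id x s)) -addrA (le_lt_trans (ler_normD _ _))//.
by rewrite (splitr e) ltrD.
Qed.

(** * Very weak compactness of balls in a reflexive space *)

(** The values lie in a segment, so they cluster at some point, and an
    ultrafilter converges to its cluster points. *)
Lemma ultra_bounded_cvg (R : realType) (I : Type) (F : set_system I)
    (h : I -> R) (M : R) :
  UltraFilter F -> (forall i, `|h i| <= M) ->
  exists l : R, h i @[i --> F] --> l.
Proof.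
move=> UF hM.
have Fseg : (h @ F) `[- M, M]%classic.
  by apply: nearW => i; rewrite /= in_itv/= -ler_norml.
have [l [_ hl]] := @segment_compact R (- M) M (h @ F) _ Fseg.
exists l => U Ul.
have [//|nU] := in_ultra_setVsetC (h @^-1` U) UF.
by have [y []] := hl (~` U) U nU Ul.
Qed.

(** The weak compactness of balls in a reflexive space: the limits of the
    functionals along [F] form an element of the bidual, hence an evaluation at
    some [l]; a functional norming [l] shows that [l] stays in the ball. *)
Lemma reflexive_ultra_weak_cvg (R : realType) (X : normedModType R) (r : R)
    (I : Type) (F : set_system I) (x : I -> X) :
  reflexive_space X -> UltraFilter F -> (forall i, `|x i| <= r) ->
  exists2 l : X, `|l| <= r &
    forall f : dual X, f (x i) @[i --> F] --> (f l : R).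
Proof.
move=> reflX UF xr.
have fx (f : dual X) i : `|f (x i)| <= r * `|f|.
  by rewrite mulrC (le_trans (dual_apply_le f (x i)))// ler_wpM2l.
have /choice[L FL] : forall f : dual X, exists l : R, f (x i) @[i --> F] --> l.
  by move=> f; exact: (ultra_bounded_cvg UF (fx f)).
have Ll : linear (L : dual X -> R^o).
  move=> a f g; apply: (cvg_unique (@norm_hausdorff _ _) (FL (a *: f + g))).
  by apply: cvgD (FL g); apply: cvgMl_tmp (FL f).
have Lle f : `|L f| <= r * `|f|.
  by apply: (cvgr_to_le (cvg_norm (FL f))); apply: nearW => i; exact: fx.
have [G GL] := bounded_linear_dual Ll Lle.
have [l lG] := reflX G.
have fl (f : dual X) : f l = L f by rewrite -GL -lG.
exists l; last by move=> f; rewrite fl; exact: FL.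
have [f f1 fle] := norming_functional l.
rewrite -fle fl (le_trans (ler_norm _))// (le_trans (Lle f))//.
have r0 : 0 <= r.
  by have [i _] := filter_ex (@filterT _ F _); exact: le_trans (xr i).
by rewrite ler_piMr.
Qed.

Theorem very_weak_ball_compact (R : realType) (X : normedModType R)
    (phi : nat -> dual X) (hPhi : is_norm (very_weak_norm phi)) (r : R) :
  dense_in_dual_ball phi -> reflexive_space X ->
  compact [set: @metric_subspace R (normed_by hPhi) (norm_ball X r)].
Proof.
move=> phid reflX; rewrite compact_ultra => F UF _.
have phi1 := dense_in_dual_ball_le1 phid.
pose x (s : @metric_subspace R (normed_by hPhi) (norm_ball X r)) : X := set_val s.
have xr s : `|x s| <= r by exact: (set_valP s).
have [l lr xl] := reflexive_ultra_weak_cvg reflX UF xr.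
pose p : @metric_subspace R (normed_by hPhi) (norm_ball X r) :=
  SigSub (mem_set (lr : norm_ball X r l)).
exists p; split => //.
have lx : very_weak_norm phi (l - x s) @[s --> F] --> (0 : R).
  apply: (@very_weak_cvg0 _ _ _ phi1 _ _ _ _ (r + r)).
    by move=> s; rewrite (le_trans (ler_normB _ _))// lerD.
  move=> k; rewrite -(subrr (phi k l)).
  under eq_fun do rewrite linearB.
  by apply: cvgB (xl (phi k)); exact: cvg_cst.
apply/fcvg_ballP => e e0.
move/cvgr0Pnorm_lt : lx => /(_ e e0); apply: filterS => s.
rewrite metric_subspace_ballE.
exact: le_lt_trans (ler_norm _).
Qed.

(** * Injective completely continuous operators on a reflexive space *)

Lemma metric_subspace_continuous (R : realType) (V : normedModType R)
    (B : set V) (U : pseudoMetricType R) (h : metric_subspace B -> U) :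
  (forall x e, 0 < e -> exists2 d : R, 0 < d &
     forall y, `|set_val x - set_val y| < d -> ball (h x) e (h y)) ->
  continuous h.
Proof.
move=> hd x W /nbhs_ballP[e /= e0 hW]; have [d d0 hxy] := hd x e e0.
apply/nbhs_ballP; exists d => // y xy; apply: hW; apply: hxy.
by rewrite -metric_subspace_ballE.
Qed.

Section Reflexive.
Context (R : realType) (X Y : normedModType R) (phi : nat -> dual X)
  (T : {linear X -> Y}) (hPhi : is_norm (very_weak_norm phi)).
Hypotheses (phid : dense_in_dual_ball phi) (ccT : completely_continuous T).
Hypothesis (reflX : reflexive_space X).

Local Notation N := (very_weak_norm phi).
Local Notation weak_ball r :=
  (@metric_subspace R (normed_by hPhi) (norm_ball X r)).
Local Notation image_ball r := (metric_subspace (T @` norm_ball X r)).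

Let diam (r : R) (u v : X) : `|u| <= r -> `|v| <= r -> `|u - v| <= r + r.
Proof. by move=> ur vr; rewrite (le_trans (ler_normB _ _))// lerD. Qed.

(** The first inequality applied to differences: uniform continuity on balls is
    the only form in which compactness and the homeomorphism use it. *)
Lemma modulus_T (r e : R) : 0 < e -> exists2 d : R, 0 < d &
  forall u v, `|u| <= r -> `|v| <= r -> N (u - v) < d -> `|T u - T v| < e.
Proof.
move=> e0.
have [d d0 dP] := @ehrling_modulus _ _ (fun u => `|T u|) N
  (completely_continuous_Ehrling phid ccT) (r + r) e e0.
by exists d => // u v ur vr uvd; rewrite -linearB; apply: dP => //; exact: diam.
Qed.

Lemma compact_operator_of_reflexive : compact_operator T.
Proof.
move=> A [M0 [_ AM0]]; pose M := M0 + 1.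
have AM u : A u -> `|u| <= M by apply: AM0; rewrite ltrDl.
apply: (@precompact_subset _ _ (T @` norm_ball X M)).
  by move=> _ [u Au <-]; exists u => //; exact: AM.
apply: compact_precompact; first exact: norm_hausdorff.
pose h (s : weak_ball M) : Y := T (set_val s).
have -> : T @` norm_ball X M = h @` [set: weak_ball M].
  apply/seteqP; split=> [_ [u uM <-]|_ [s _ <-]].
    by exists (SigSub (mem_set uM)).
  by exists (set_val s) => //; exact: (set_valP s).
apply: continuous_compact; last exact: very_weak_ball_compact.
apply: continuous_subspaceT; apply: metric_subspace_continuous => s e e0.
have [d d0 dP] := modulus_T M e0; exists d => // t st.
rewrite -ball_normE; apply: dP => //; [exact: (set_valP s)|exact: (set_valP t)].
Qed.

Hypothesis (injT : injective T).

(** The rescaled sequence [w] has very weak norm 1, while [T (w n)] tends to 0.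
    By compactness it has a cluster point [u] for the very weak norm; continuity
    of [T] on the ball gives [T u = 0], so [u = 0], and some [w m] is then at
    very weak distance less than 1 from 0. *)
Theorem reverse_Ehrling (eps : R) : 0 < eps ->
  exists2 C : R, 0 < C & forall u, N u <= eps * `|u| + C * `|T u|.
Proof.
move=> eps0.
apply: (@ehrling_by_contradiction _ _ N (fun u => `|T u|)) => //.
- exact: is_normZ.
- by move=> a u; rewrite linearZ normrZ.
move=> w wM Nw1 Tw.
pose s n : weak_ball eps^-1 := SigSub (mem_set (wM n : norm_ball X _ (w n))).
have [p [_ sp]] := @very_weak_ball_compact _ _ _ hPhi eps^-1 phid reflX
  (s @ \oo) _ filterT.
pose u : X := set_val p.
have uM : `|u| <= eps^-1 by exact: (set_valP p).
(* The terms of rank at least [n] meet every ball around the cluster point. *)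
have near_u n d : 0 < d -> exists2 m, (n <= m)%N & N (u - w m) < d.
  move=> d0.
  have [_ [[m nm <-]]] := sp [set s m | m in [set m | (n <= m)%N]] (ball p d)
    (filterS (fun m (nm : (n <= m)%N) => ex_intro2 _ _ m nm erefl) (nbhs_infty_ge n))
    (nbhsx_ballx p d d0).
  by rewrite metric_subspace_ballE => ?; exists m.
have Tu0 : T u = 0.
  apply/eqP; rewrite -normr_le0; apply/ler_addgt0Pl => e e0.
  rewrite addr0.
  have e20 : 0 < e / 2 by rewrite divr_gt0.
  have [d d0 dP] := modulus_T eps^-1 e20.
  have [n] := ltr_add_invr e20; rewrite add0r => ne.
  have [m nm um] := near_u n d d0.
  rewrite -(subrK (T (w m)) (T u)) (le_trans (ler_normD _ _))// (splitr e).
  rewrite lerD//; first by rewrite ltW// dP.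
  rewrite (le_trans (Tw m))// (le_trans _ (ltW ne))// lef_pV2 ?posrE//.
  by rewrite ler_nat.
have u0 : u = 0 by apply: injT; rewrite Tu0 linear0.
have [m _] := near_u 0%N 1 ltr01.
by rewrite u0 -(opprB (w m)) subr0 -scaleN1r (is_normZ hPhi) normrN normr1 mul1r
  Nw1 ltxx.
Qed.

Theorem image_ball_homeomorphic (r : R) :
  homeomorphic (image_ball r) (weak_ball r).
Proof.
(* [g] is [T] restricted to the ball and [f] is its inverse. *)
pose g (s : weak_ball r) : image_ball r :=
  SigSub (mem_set (ex_intro2 _ _ (set_val s) (set_valP s) erefl :
    (T @` norm_ball X r) (T (set_val s)))).
have /choice[f fE] : forall y : image_ball r, exists s : weak_ball r,
    T (set_val s) = set_val y.
  move=> y; have [u ur uy] := set_valP y.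
  by exists (SigSub (mem_set ur)).
have fg : cancel f g.
  by move=> y; apply: val_inj; exact: fE.
have gf : cancel g f.
  by move=> s; apply: val_inj; apply: injT; exact: fE.
have vr (s : weak_ball r) : `|(set_val s : X)| <= r by exact: (set_valP s).
exists f, g; split => //.
- apply: metric_subspace_continuous => x e e0.
  have [d d0 dP] := @ehrling_modulus _ _ N (fun u => `|T u|)
    reverse_Ehrling (r + r) e e0.
  exists d => // y; rewrite -!fE => xy; rewrite metric_subspace_ballE.
  by apply: dP; [exact: diam|rewrite linearB].
- apply: metric_subspace_continuous => x e e0.
  have [d d0 dP] := modulus_T r e0; exists d => // y xy.
  by rewrite metric_subspace_ballE; apply: dP.
Qed.

End Reflexive.

Theorem theorem1p15 (R : realType) (X Y : normedModType R)
    (phi : nat -> dual X) (T : {linear X -> Y}) :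
  separable (dual X) ->
  dense_in_dual_ball phi ->
  completely_continuous T ->
  exists hPhi : is_norm (very_weak_norm phi),
    Ehrling_continuous T (fun u : X => `|u|) (very_weak_norm phi) /\
    (reflexive_space X -> injective T ->
      [/\ separable X, compact_embedding T,
          forall r : R, 0 < r ->
            homeomorphic (metric_subspace (T @` norm_ball X r))
              (@metric_subspace R (normed_by hPhi) (norm_ball X r)) /\
            compact [set: @metric_subspace R (normed_by hPhi) (norm_ball X r)]
        & forall eps : R, 0 < eps -> exists2 C : R, 0 < C &
            forall u : X, very_weak_norm phi u <= eps * `|u| + C * `|T u|]).
Proof.
move=> _ phid ccT; have hPhi := very_weak_norm_is_norm phid.
exists hPhi; split; first exact: completely_continuous_Ehrling.
move=> reflX injT; split.
- exact: separable_of_dense_dual_ball phid.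
- by split => //; exact: (compact_operator_of_reflexive hPhi).
- move=> r _; split; last exact: very_weak_ball_compact.
  exact: image_ball_homeomorphic.
- exact: reverse_Ehrling.
Qed.
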